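(* Let $\mu$ be a maximal partial measure on a $\sigma$-algebra $\mathcal{A}$ of subsets of a set $\Omega$. Then the formulas $$\mu^+(A)=\sup_{F\in\mathcal{F}^+(\mu)}\mu(A\cap F),\qquad \mu^-(A)=\sup_{F\in\mathcal{F}^-(\mu)}\bigl(-\mu(A\cap F)\bigr)\qquad (A\in\mathcal{A})$$ define two positive measures $\mu^+,\mu^-$ on $\mathcal{A}$ such that $\mu=\mu^+-\mu^-$ (equality of partial measures, including equality of domains). Moreover, if $\mu_1$ is a positive measure on $\mathcal{A}$ with $\mu(A)\le\mu_1(A)$ for all $A\in\mathcal{D}(\mu)$, then $\mu^+\le\mu_1$. Similarly, if $\mu_2$ is a positive measure on $\mathcal{A}$ with $-\mu(A)\le\mu_2(A)$ for all $A\in\mathcal{D}(\mu)$, then $\mu^-\le\mu_2$.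
   Context: $\overline{\mathbb{R}}=\mathbb{R}\cup\{-\infty\}\cup\{+\infty\}$ is the extended real line. A measure on a $\sigma$-algebra $\mathcal{A}$ is a $\sigma$-additive set function $\mu:\mathcal{A}\to\overline{\mathbb{R}}$ with $\mu(\emptyset)=0$ (so it takes at most one of the values $+\infty,-\infty$); a positive measure is a measure with values in $[0,+\infty]$. A set function $\mu:\mathcal{D}(\mu)\to\overline{\mathbb{R}}$ defined on a nonvoid subclass $\mathcal{D}(\mu)\subset\mathcal{A}$ is called a partial measure on $\mathcal{A}$ if for every $B\in\mathcal{D}(\mu)$ the restriction $\mu|_{\mathcal{A}\cap B}$ is a measure on the $\sigma$-algebra $\mathcal{A}\cap B=\{A\cap B: A\in\mathcal{A}\}$ (in particular $\mathcal{A}\cap B\subset\mathcal{D}(\mu)$). A partial measure is maximal if it has no proper extension to a partial measure on $\mathcal{A}$. For a partial measure $\mu$ on $\mathcal{A}$, $\mathcal{F}^+(\mu)$ is the class of all $F\in\mathcal{D}(\mu)$ such that $\mu(A)\ge 0$ for every $A\in\mathcal{A}$ with $A\subset F$, and $\mathcal{F}^-(\mu)$ is the class of all $F\in\mathcal{D}(\mu)$ such that $\mu(A)\le 0$ for every $A\in\mathcal{A}$ with $A\subset F$. For positive measures $\mu_1,\mu_2$ on $\mathcal{A}$, $\mu_1-\mu_2$ denotes the partial measure with domain $\mathcal{D}(\mu_1-\mu_2)=\{A\in\mathcal{A}:\mu_1(A)-\mu_2(A)\text{ is well-posed}\}$ (i.e. not of the form $\infty-\infty$: $\mu_1(A)$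 and $\mu_2(A)$ are not both $+\infty$), given by $(\mu_1-\mu_2)(A)=\mu_1(A)-\mu_2(A)$. *)

(* Defs.v *)
From HB Require Import structures.
From mathcomp Require Import all_boot all_order all_algebra.
From mathcomp Require Import all_classical all_reals all_analysis.

Set Implicit Arguments.
Unset Strict Implicit.
Unset Printing Implicit Defensive.

Import Order.TTheory GRing.Theory Num.Theory.
Import numFieldNormedType.Exports.

Local Open Scope classical_set_scope.
Local Open Scope ring_scope.
Local Open Scope ereal_scope.

(* The sigma-algebra is a class [S] of subsets of an
   arbitrary (possibly empty) type [T] with [sigma_algebra setT S]; a
   measurableType would force the underlying set to be nonempty. *)

(* [mu] is only looked at on the members of [S]. The second clause is what makes
   every partial sum well-posed: the library sets +oo - oo := -oo, so countable
   additivity alone would not exclude both infinities. *)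
Definition is_measure (R : realType) (T : Type) (S : set (set T))
    (mu : set T -> \bar R) : Prop :=
  [/\ mu set0 = 0,
      ~ (exists A B, [/\ S A, S B, mu A = +oo & mu B = -oo]) &
      forall F : (set T)^nat, (forall n, S (F n)) -> trivIset setT F ->
        \sum_(0 <= i < n) mu (F i) @[n --> \oo] --> mu (\bigcup_n F n)].

Definition is_positive_measure (R : realType) (T : Type) (S : set (set T))
    (mu : set T -> \bar R) : Prop :=
  is_measure S mu /\ forall A, S A -> 0 <= mu A.

(* The values of [sfun] outside [sdom] are meaningless; set functions are
   compared with [sf_eq], not with Leibniz equality. *)
Record set_function (R : realType) (T : Type) := SetFunction {
  sdom : set (set T) ;
  sfun :> set T -> \bar R }.

Definition sf_extends (R : realType) (T : Type)
    (nu mu : set_function R T) : Prop :=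
  sdom mu `<=` sdom nu /\ forall A, sdom mu A -> nu A = mu A.

Definition sf_eq (R : realType) (T : Type) (mu nu : set_function R T) : Prop :=
  sdom mu = sdom nu /\ forall A, sdom mu A -> mu A = nu A.

(* [strace S B] is the trace sigma-algebra {A `&` B : A in S}. *)
Definition is_partial_measure (R : realType) (T : Type) (S : set (set T))
    (mu : set_function R T) : Prop :=
  [/\ sdom mu !=set0, sdom mu `<=` S &
      forall B, sdom mu B ->
        strace S B `<=` sdom mu /\ is_measure (strace S B) mu].

Definition is_maximal_partial_measure (R : realType) (T : Type)
    (S : set (set T)) (mu : set_function R T) : Prop :=
  is_partial_measure S mu /\
  forall nu : set_function R T,
    is_partial_measure S nu -> sf_extends nu mu -> sdom nu = sdom mu.

Definition positive_sets (R : realType) (T : Type) (S : set (set T))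
    (mu : set_function R T) : set (set T) :=
  [set F | sdom mu F /\ forall A, S A -> A `<=` F -> 0 <= mu A].

Definition negative_sets (R : realType) (T : Type) (S : set (set T))
    (mu : set_function R T) : set (set T) :=
  [set F | sdom mu F /\ forall A, S A -> A `<=` F -> mu A <= 0].

Definition positive_part (R : realType) (T : Type) (S : set (set T))
    (mu : set_function R T) (A : set T) : \bar R :=
  ereal_sup [set mu (A `&` F) | F in positive_sets S mu].

Definition negative_part (R : realType) (T : Type) (S : set (set T))
    (mu : set_function R T) (A : set T) : \bar R :=
  ereal_sup [set - mu (A `&` F) | F in negative_sets S mu].

(* [x +? y] holds iff x + y is not of the form +oo - oo. *)
Definition measure_diff (R : realType) (T : Type) (S : set (set T))
    (mu1 mu2 : set T -> \bar R) : set_function R T :=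
  SetFunction [set A | S A /\ mu1 A +? - mu2 A] (fun A => mu1 A - mu2 A).

(* Main.v *)
Require Import Defs.
From mathcomp Require Import all_boot all_order all_algebra.
From mathcomp Require Import all_classical all_reals all_analysis.

Set Implicit Arguments.
Unset Strict Implicit.
Unset Printing Implicit Defensive.

Import Order.TTheory GRing.Theory Num.Theory.
Import numFieldNormedType.Exports.

Local Open Scope classical_set_scope.
Local Open Scope ring_scope.
Local Open Scope ereal_scope.

(** On a set X of the domain, mu is a genuine measure, so it has a Hahn
    decomposition: X splits into a positive set P and a negative set X \ P
    ([partial_measure_hahn]). Any other positive set F meets X \ P in a set of
    measure 0, hence the supremum defining mu^+(X) is attained at P; likewise
    mu^-(X) = - mu(X \ P). This gives mu = mu^+ - mu^- on the domain of mu
    ([partial_measureE]); the difference is well-posed since a measure on the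
    subsets of X cannot take both infinite values.

    That mu^+ is a measure requires maximality. Each F in F^+(mu) defines a
    positive measure A |-> mu(A `&` F), and a supremum of an upward directed
    family of positive measures is a measure ([ereal_sup_directed_measure]). The
    family is directed because F^+(mu) is stable under union
    ([positive_setsU]): if F and G are positive, then
    A |-> mu(A `&` F) + mu(A `&` (G \ F)) extends mu to the subsets of
    F `|` G, and by maximality these sets are already in the domain. Without
    maximality the claim fails: if the domain consists of the subsets of F and
    those of G, with F and G disjoint positive sets of finite nonzero measure,
    then mu^+(F `|` G) is the maximum of mu(F) and mu(G) instead of their sum.

    Once mu^+ and mu^- are known to be measures, mu^+ - mu^- is a partial measure
    ([is_partial_measure_diff]) which extends mu, so maximality makes the domains
    agree. A positive measure mu1 above mu satisfies
    mu(A `&` F) <= mu1(A `&` F) <= mu1(A), whence mu^+ <= mu1. The statements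
    about mu^- are those about mu^+ for the partial measure - mu.

    The Hahn decomposition is proved for measures that may take one infinite
    value, by a greedy argument ([exhaustion]) used twice: to find inside a set of
    negative measure a negative set which is at least as negative, and then to
    find a negative set whose complement contains no further negative set of
    nonzero measure. *)

(** * Sigma-algebras and extended real measures *)

Lemma sigma_algebraU (T : Type) (S : set (set T)) (A B : set T) :
  sigma_algebra setT S -> S A -> S B -> S (A `|` B).
Proof.
move=> [S0 _ Sb] SA SB; rewrite -bigcup2E; apply: Sb => -[|[|n]] //.
Qed.

Lemma sigma_algebraI (T : Type) (S : set (set T)) (A B : set T) :
  sigma_algebra setT S -> S A -> S B -> S (A `&` B).
Proof. by move=> /sigma_algebraP[//|_ _ _]; apply. Qed.

Lemma sigma_algebraD (T : Type) (S : set (set T)) (A B : set T) :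
  sigma_algebra setT S -> S A -> S B -> S (A `\` B).
Proof.
move=> hS SA SB; rewrite setDE; apply: sigma_algebraI => //.
by have [_ SC _] := hS; rewrite -setTD; exact: SC.
Qed.

Lemma straceP (T : Type) (S : set (set T)) (X A : set T) :
  sigma_algebra setT S -> S X -> strace S X A <-> S A /\ A `<=` X.
Proof.
move=> hS SX; split=> [[B SB <-]|[SA AX]].
  by split; [exact: sigma_algebraI|exact: subIsetr].
by exists A => //; exact/setIidPl.
Qed.

Lemma is_measure_sub (R : realType) (T : Type) (M M' : set (set T))
    (nu : set T -> \bar R) : M' `<=` M -> is_measure M nu -> is_measure M' nu.
Proof.
move=> sub [nu0 nuinf nusum]; split=> //.
  by move=> [A [B [/sub MA /sub MB nuA nuB]]]; apply: nuinf; exists A, B.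
by move=> F MF; apply: nusum => n; exact/sub.
Qed.

Lemma eq_is_measure (R : realType) (T : Type) (M : set (set T))
    (nu nu' : set T -> \bar R) : M set0 ->
  (forall F : (set T)^nat, (forall n, M (F n)) -> M (\bigcup_n F n)) ->
  (forall A, M A -> nu A = nu' A) -> is_measure M nu -> is_measure M nu'.
Proof.
move=> M0 Mb e [nu0 nuinf nusum]; split.
- by rewrite -e.
- move=> [A [B [MA MB]]]; rewrite -!e// => nuA nuB.
  by apply: nuinf; exists A, B.
- move=> F MF tF; rewrite -e; last exact: Mb.
  under eq_fun do under eq_bigr do rewrite -e//.
  exact: nusum.
Qed.

(** Measures on a trace become measures on the whole of [S]; the results below
    can thus be stated for [S] only and applied to every set of the domain of a
    partial measure. *)
Lemma is_measure_restr (R : realType) (T : Type) (S : set (set T))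
    (X : set T) (nu : set T -> \bar R) :
  is_measure (strace S X) nu -> is_measure S (fun A => nu (A `&` X)).
Proof.
have tr A : S A -> strace S X (A `&` X) by exists A.
move=> [nu0 nuinf nusum]; split.
- by rewrite set0I.
- move=> [A [B [SA SB nuA nuB]]]; apply: nuinf.
  by exists (A `&` X), (B `&` X); split => //; exact: tr.
- move=> F SF tF; rewrite setI_bigcupl; apply: nusum => [n|]; first exact: tr.
  exact: trivIset_setIr.
Qed.

(** Finite additivity comes from sigma-additivity by padding with empty sets. *)
Lemma is_measureU (R : realType) (T : Type) (M : set (set T))
    (nu : set T -> \bar R) (A B : set T) :
  M set0 -> is_measure M nu -> M A -> M B -> A `&` B = set0 ->
  nu (A `|` B) = nu A + nu B.
Proof.
move=> M0 [nu0 _ nusum] MA MB AB.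
have Mb n : M (bigcup2 A B n) by case: n => [|[|n]].
have tb : trivIset setT (bigcup2 A B) by rewrite -trivIset_bigcup2.
have := nusum _ Mb tb; rewrite bigcup2E => cvg1.
rewrite -(cvg_lim _ cvg1)//; apply: cvg_lim => //; apply: cvg_near_cst.
exists 2%N => // n /= n2.
rewrite (@big_cat_nat _ _ _ 2)//= big_nat_recl// big_nat1/=.
by rewrite big_nat big1 ?adde0// => -[|[|i]].
Qed.

Lemma is_measureN (R : realType) (T : Type) (M : set (set T))
    (nu : set T -> \bar R) : is_measure M nu -> is_measure M (fun A => - nu A).
Proof.
move=> [nu0 nuinf nusum]; split.
- by rewrite nu0 oppe0.
- move=> [A [B [MA MB /eqP]]]; rewrite eqe_oppLR => /eqP nuA /eqP.
  by rewrite eqe_oppLR => /eqP nuB; apply: nuinf; exists B, A.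
- move=> F MF tF.
  have -> : (fun n => \sum_(0 <= i < n) - nu (F i)) =
            (fun n => - \sum_(0 <= i < n) nu (F i)).
    apply/funext => n; apply: sumeN => i j _ _; apply/andP; split; apply/negP.
      by move=> /andP[/eqP a /eqP b]; apply: nuinf; exists (F i), (F j).
    by move=> /andP[/eqP a /eqP b]; apply: nuinf; exists (F j), (F i).
  by apply: cvgeN; exact: nusum.
Qed.

(** The partial sums may be split without any condition, because addition of
    extended reals is commutative and associative even when ill-posed; only the
    passage to the limit needs well-posedness, for the measures of the union. *)
Lemma is_measure_add (R : realType) (T : Type) (M : set (set T))
    (nu1 nu2 : set T -> \bar R) :
  (forall F : (set T)^nat, (forall n, M (F n)) -> M (\bigcup_n F n)) ->
  (forall A, M A -> nu1 A +? nu2 A) ->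
  ~ (exists A B, [/\ M A, M B, nu1 A + nu2 A = +oo & nu1 B + nu2 B = -oo]) ->
  is_measure M nu1 -> is_measure M nu2 ->
  is_measure M (fun A => nu1 A + nu2 A).
Proof.
move=> Mb wp inf [n10 _ s1] [n20 _ s2]; split => //.
- by rewrite n10 n20 adde0.
- move=> F MF tF; under eq_fun do rewrite big_split/=.
  by apply: cvgeD; [apply/wp/Mb|exact: s1|exact: s2].
Qed.

Lemma is_measureD (R : realType) (T : Type) (S : set (set T))
    (nu : set T -> \bar R) (A B : set T) : sigma_algebra setT S ->
  is_measure S nu -> S A -> S B -> A `<=` B -> nu B = nu A + nu (B `\` A).
Proof.
move=> hS mnu SA SB AB; have [S0 _ _] := hS; rewrite -[in LHS](setDUK AB).
by rewrite (is_measureU S0 mnu)//; [exact: sigma_algebraD|exact: setDIK].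
Qed.

Lemma is_positive_measure_mono (R : realType) (T : Type) (S : set (set T))
    (nu : set T -> \bar R) (A B : set T) : sigma_algebra setT S ->
  is_positive_measure S nu -> S A -> S B -> A `<=` B -> nu A <= nu B.
Proof.
move=> hS [mnu ge0] SA SB AB; rewrite (is_measureD hS mnu SA SB AB) leeDl//.
by apply: ge0; exact: sigma_algebraD.
Qed.

(** * Hahn decomposition *)

(** The sets [B n] are chosen greedily: [B n] lies in what the previous ones have
    left, and its measure is at least 1 or at least half of the supremum over the
    available members of [Q]. If a member of [Q] of measure c > 0 survived, every
    [B n] would have measure at least min(1, c/2), and their union would have
    infinite measure. The bound 1 is there because the supremum may be infinite
    although each value is not. *)
Lemma exhaustion (R : realType) (T : Type) (S Q : set (set T))
    (nu : set T -> \bar R) :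
  sigma_algebra setT S -> Q set0 -> is_measure S nu ->
  (forall A, S A -> nu A < +oo) ->
  exists B : (set T)^nat,
    [/\ forall n, [/\ S (B n), Q (B n) & 0 <= nu (B n)], trivIset setT B &
        forall C, S C -> Q C -> C `<=` ~` (\bigcup_n B n) -> nu C <= 0].
Proof.
move=> hS Q0 mnu fin; have [S0 _ Sb] := hS; have [nu0 _ nusum] := mnu.
(* The greedy choice inside the remaining set [A]. *)
have step (A : set T) : exists B : set T, S A ->
  [/\ S B, B `<=` A, Q B, 0 <= nu B & forall C, S C -> Q C -> C `<=` A ->
     nu B < 1 -> nu C <= nu B + nu B].
  have [SA|nSA] := pselect (S A); last by exists set0.
  have [[B [SB QB BA nuB]]|no] :=
    pselect (exists B, [/\ S B, Q B, B `<=` A & 1 <= nu B]).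
    exists B => _; split=> //; first exact: le_trans nuB.
    by move=> C _ _ _; rewrite ltNge nuB.
  pose E := [set nu B | B in [set B | [/\ S B, Q B & B `<=` A]]].
  have E0 : E 0 by exists set0 => /=; [split|].
  have Ele x : E x -> x <= 1.
    move=> [B [SB QB BA] <-]; rewrite leNgt; apply/negP => /ltW h.
    by apply: no; exists B.
  have s0 : 0 <= ereal_sup E by exact: ereal_sup_ubound.
  have s1 : ereal_sup E <= 1 by exact: ge_ereal_sup.
  have sfin : ereal_sup E \is a fin_num.
    by rewrite fin_numElt (lt_le_trans _ s0)// (le_lt_trans s1)// ltry.
  have [s_eq0|s_neq0] := eqVneq (ereal_sup E) 0.
    exists set0 => _; split => //; first by rewrite nu0.
    move=> C SC QC CA _; rewrite nu0 adde0 -s_eq0.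
    by apply: ereal_sup_ubound; exists C.
  have sgt0 : 0 < ereal_sup E by rewrite lt_neqAle eq_sym s_neq0.
  have : (fine (ereal_sup E) / 2)%:E < ereal_sup E.
    rewrite -[ltRHS]fineK// lte_fin ltr_pdivrMr// ltr_pMr ?ltr1n//.
    by rewrite fine_gt0// sgt0 (le_lt_trans s1)// ltry.
  move=> /ereal_sup_gt[_ [B [SB QB BA] <-] ltB].
  exists B => _; split => //.
    by apply/ltW/(le_lt_trans _ ltB); rewrite lee_fin divr_ge0// fine_ge0.
  move=> C SC QC CA _; apply: (@le_trans _ _ (ereal_sup E)).
    by apply: ereal_sup_ubound; exists C.
  rewrite -[leLHS]fineK// [fine _]splitr EFinD.
  by apply: leeD; exact: ltW.
have [g gP] := choice step.
(* [D n] is what remains before the n-th choice. *)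
pose D := fix D n := if n is n'.+1 then D n' `\` g (D n') else setT.
have ST : S setT by have [_ /(_ _ S0)] := hS; rewrite setD0.
have SD n : S (D n).
  elim: n => //= n ih; apply: sigma_algebraD => //.
  by have [] := gP _ ih.
pose B n := g (D n).
have Dsub m n : (m <= n)%N -> D n `<=` D m.
  elim: n => [|n ih]; first by rewrite leqn0 => /eqP->.
  by rewrite leq_eqVlt => /predU1P[->//|/ih mn] x /= [/mn].
have BD n : B n `<=` D n by have [] := gP _ (SD n).
have tB : trivIset setT B.
  apply/trivIsetP => /= m n _ _.
  wlog: m n / (m < n)%N => [h|mn _].
    by rewrite neq_lt => /orP[mn|nm]; [|rewrite setIC]; apply: h => //;
      rewrite ltn_eqF.
  rewrite -subset0 => x /= [Bm Bn].
  by have /(Dsub _ _ mn)/= [_] := BD _ _ Bn.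
have BP n : [/\ S (B n), Q (B n) & 0 <= nu (B n)] by have [] := gP _ (SD n).
exists B; split => // C SC QC CB; rewrite leNgt; apply/negP => nuC.
have CD n : C `<=` D n.
  elim: n => //= n ih x Cx; split; first exact: ih.
  by move=> Bx; apply: (CB _ Cx); exists n.
have Cfin : nu C \is a fin_num.
  by rewrite fin_numElt (lt_trans _ nuC)// fin.
(* From here on, [C] is a survivor of positive measure. *)
pose d := Num.min 1%R (fine (nu C) / 2)%R.
have d0 : (0 < d)%R.
  by rewrite lt_min ltr01/= divr_gt0// fine_gt0// nuC fin.
have dB n : d%:E <= nu (B n).
  have [_ _ _ _ /(_ C SC QC (CD n)) h] := gP _ (SD n).
  have [B1|/h{}h] := leP 1 (nu (B n)).
    by apply: le_trans B1; rewrite lee_fin ge_min lexx.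
  have [SB _ B0] := BP n.
  have Bfin : nu (B n) \is a fin_num.
    by rewrite fin_numElt (lt_le_trans _ B0)// fin.
  rewrite -[leRHS]fineK// lee_fin ge_min ler_pdivrMr//; apply/orP; right.
  by rewrite mulr_natr mulr2n -lee_fin EFinD !fineK.
have cv := nusum B (fun n => let: And3 a _ _ := BP n in a) tB.
have lb n : (d *+ n)%:E <= nu (\bigcup_n B n).
  have -> : nu (\bigcup_n B n) = \sum_(0 <= i <oo) nu (B i).
    by apply/esym/cvg_lim.
  apply: le_trans (nneseries_lim_ge n _); last by move=> i _ _; have [] := BP i.
  elim: n => [|n ih]; first by rewrite big_nil.
  by rewrite big_nat_recr//= mulrSr EFinD leeD.
have SU : S (\bigcup_n B n) by apply: Sb => n; have [] := BP n.
have Ufin : nu (\bigcup_n B n) \is a fin_num.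
  by rewrite fin_numElt fin// (lt_le_trans _ (lb 0%N))// ltNyr.
have [n] : exists n, (fine (nu (\bigcup_n B n)) < d *+ n)%R.
  exists (Num.trunc (fine (nu (\bigcup_n B n)) / d)).+1.
  by rewrite -mulr_natr mulrC -ltr_pdivrMr// truncnS_gt.
by rewrite ltNge -lee_fin fineK// lb.
Qed.

(** Exhausting [A] by sets of nonnegative measure leaves a negative set, and
    removing sets of nonnegative measure can only decrease the measure. The greedy
    argument applies because a set of finite measure has only subsets of finite
    measure when the value -oo is excluded. *)
Lemma negative_subset (R : realType) (T : Type) (S : set (set T))
    (nu : set T -> \bar R) (A : set T) :
  sigma_algebra setT S -> is_measure S nu -> (forall B, S B -> -oo < nu B) ->
  S A -> nu A < +oo ->
  exists N, [/\ S N, N `<=` A, nu N <= nu A &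
    forall C, S C -> C `<=` N -> nu C <= 0].
Proof.
move=> hS mnu gtNy SA ltA; have [S0 _ Sb] := hS.
have addA B (SB : S B) := is_measureD hS mnu SB SA.
have fin B : S B -> nu (B `&` A) < +oo.
  move=> SB; have SBA := sigma_algebraI hS SB SA.
  have [h|h] := eqVneq (nu (B `&` A)) +oo; last by rewrite ltey.
  move: ltA; rewrite (addA _ SBA (@subIsetr _ _ _)) h addye ?ltxx// gt_eqF//.
  by apply: gtNy; exact: sigma_algebraD.
have mA : is_measure S (fun B => nu (B `&` A)).
  apply: is_measure_restr; apply: is_measure_sub mnu => B /(straceP _ hS SA).
  by case.
have [B [SB tB neg]] := @exhaustion R T S setT _ hS I mA fin.
have SU : S (\bigcup_n B n) by apply: Sb => n; have [] := SB n.
have SUA := sigma_algebraI hS SU SA.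
exists (A `\` (\bigcup_n B n)); split.
- exact: sigma_algebraD.
- exact: subDsetl.
- rewrite (addA _ SUA (@subIsetr _ _ _)) setDIr setDv setU0.
  rewrite leeDr//.
  have [_ _ /(_ B (fun n => let: And3 a _ _ := SB n in a) tB) cv] := mA.
  rewrite -(cvg_lim _ cv)//; apply: nneseries_ge0 => n _ _.
  by have [] := SB n.
- move=> C SC CN; have /setIidPl <- : C `<=` A by move=> x /CN[].
  by apply: neg => // x /CN[].
Qed.

(** Negative sets are exhausted with respect to [- nu], which omits +oo. Were the
    measure of some subset of the remaining set negative, [negative_subset] would
    give there one more negative set of nonzero measure. *)
Lemma hahn_gtNy (R : realType) (T : Type) (S : set (set T))
    (nu : set T -> \bar R) :
  sigma_algebra setT S -> is_measure S nu -> (forall B, S B -> -oo < nu B) ->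
  exists P, [/\ S P, forall A, S A -> A `<=` P -> 0 <= nu A &
    forall A, S A -> A `<=` ~` P -> nu A <= 0].
Proof.
move=> hS mnu gtNy; have [S0 _ Sb] := hS; have [nu0 _ nusum] := mnu.
pose Q := [set N | forall C, S C -> C `<=` N -> nu C <= 0].
have Q0 : Q set0 by move=> C _; rewrite subset0 => ->; rewrite nu0.
have finN A : S A -> - nu A < +oo by move=> SA; rewrite lteNl gtNy.
have [B [BP tB ex]] := exhaustion hS Q0 (is_measureN mnu) finN.
have SB n : S (B n) by have [] := BP n.
have SU : S (\bigcup_n B n) by exact: Sb.
have ST : S setT by have [_ /(_ _ S0)] := hS; rewrite setD0.
exists (~` \bigcup_n B n); split.
- by rewrite -setTD; exact: sigma_algebraD.
- move=> A SA AU; rewrite leNgt; apply/negP => nuA.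
  have [N [SN NA leN QN]] :=
    negative_subset hS mnu gtNy SA (lt_trans nuA (ltry _)).
  have := ex N SN QN (subset_trans NA AU).
  by rewrite leNgt oppe_gt0 (le_lt_trans leN).
- move=> A SA; rewrite setCK => AU.
  have := nusum (fun n => A `&` B n) (fun n => sigma_algebraI hS SA (SB n)).
  move=> /(_ (trivIset_setIl tB)); rewrite -setI_bigcupr.
  have /setIidPl -> := AU => cv; rewrite -(cvg_lim _ cv)//.
  apply: lime_le; first by apply/cvg_ex; eexists; exact: cv.
  apply: nearW => n; apply: sume_le0 => i _; have [_ QB _] := BP i.
  by apply: QB; [exact: sigma_algebraI|exact: subIsetr].
Qed.

(** A measure omits one of the two infinities; if it is +oo, [hahn_gtNy] applies
    to the opposite measure. *)
Lemma hahn (R : realType) (T : Type) (S : set (set T))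
    (nu : set T -> \bar R) :
  sigma_algebra setT S -> is_measure S nu ->
  exists P, [/\ S P, forall A, S A -> A `<=` P -> 0 <= nu A &
    forall A, S A -> A `<=` ~` P -> nu A <= 0].
Proof.
move=> hS mnu; have [S0 SC _] := hS; have [_ inf _] := mnu.
have [[A [SA nuA]]|noNy] := pselect (exists A, S A /\ nu A = -oo); last first.
  apply: hahn_gtNy => // B SB; rewrite ltNge leeNy_eq; apply/negP => /eqP nuB.
  by apply: noNy; exists B.
have gtNy B : S B -> -oo < - nu B.
  move=> SB; rewrite lteNr ltNge leye_eq; apply/negP => /eqP nuB.
  by apply: inf; exists B, A.
have [P [SP pos neg]] := hahn_gtNy hS (is_measureN mnu) gtNy.
exists (~` P); split; first by rewrite -setTD; exact: SC.
- by move=> B SB BP; rewrite -oppe_le0 neg.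
- by move=> B SB; rewrite setCK => BP; rewrite -oppe_ge0 pos.
Qed.

(** * Suprema of directed families of positive measures *)

(** The nonnegative elements keep both suprema away from -oo, so that the sum on
    the left is never ill-posed. *)
Lemma ereal_supD_le (R : realType) (X Y : set (\bar R)) (c : \bar R) :
  (exists2 x, X x & 0 <= x) -> (exists2 y, Y y & 0 <= y) ->
  (forall x y, X x -> Y y -> x + y <= c) ->
  ereal_sup X + ereal_sup Y <= c.
Proof.
move=> [x0 Xx0 x0_ge0] [y0 Yy0 y0_ge0] le.
have X0 : 0 <= ereal_sup X.
  by apply: le_trans x0_ge0 _; exact: ereal_sup_ubound.
have c0 : 0 <= c by apply: le_trans (le _ _ Xx0 Yy0); exact: adde_ge0.
have Xc : ereal_sup X <= c.
  apply: ge_ereal_sup => x Xx; apply: le_trans (le _ _ Xx Yy0).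
  by rewrite leeDl.
have [->|cfin] := eqVneq c +oo; first by rewrite leey.
have Xfin : ereal_sup X \is a fin_num.
  by rewrite fin_numElt (lt_le_trans _ X0)// (le_lt_trans Xc)// ltey.
rewrite addeC -leeBrDr//; apply: ge_ereal_sup => y Yy.
rewrite leeBrDr//.
have yc : y <= c by apply: le_trans (le _ _ Xx0 Yy); rewrite leeDr.
have [->|yNy] := eqVneq y -oo; first by rewrite addNye leNye.
have yfin : y \is a fin_num.
  by rewrite fin_numE yNy lt_eqF// (le_lt_trans yc)// ltey.
rewrite addeC -leeBrDr//; apply: ge_ereal_sup => x Xx.
by rewrite leeBrDr// le.
Qed.

(** A supremum of positive measures is always countably subadditive. Directedness
    makes it finitely superadditive, since one index dominates the two indices
    chosen for two disjoint sets; being monotone, it is then countably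
    superadditive. *)
Lemma ereal_sup_directed_measure (R : realType) (T J : Type)
    (S : set (set T)) (D : set J) (m : J -> set T -> \bar R) :
  sigma_algebra setT S -> D !=set0 ->
  (forall i, D i -> is_positive_measure S (m i)) ->
  (forall i j, D i -> D j -> exists2 k, D k &
    forall A, S A -> m i A <= m k A /\ m j A <= m k A) ->
  is_positive_measure S (fun A => ereal_sup [set m i A | i in D]).
Proof.
move=> hS [i0 Di0] mP dir; set s := fun A => _.
have [S0 _ Sb] := hS.
have m_ge0 i A : D i -> S A -> 0 <= m i A by move=> /mP[_]; apply.
have m_le i A : D i -> m i A <= s A.
  by move=> Di; apply: ereal_sup_ubound; exists i.
have s_ge0 A : S A -> 0 <= s A.
  by move=> SA; apply: le_trans (m_le i0 _ Di0); exact: m_ge0.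
have s_mono A B : S A -> S B -> A `<=` B -> s A <= s B.
  move=> SA SB AB; apply: ge_ereal_sup => _ [i Di <-].
  apply: le_trans (m_le _ _ Di).
  exact: is_positive_measure_mono hS (mP _ Di) _ _ _.
have sU A B : S A -> S B -> A `&` B = set0 -> s A + s B <= s (A `|` B).
  move=> SA SB AB; apply: ereal_supD_le.
  - by exists (m i0 A); [exists i0|exact: m_ge0].
  - by exists (m i0 B); [exists i0|exact: m_ge0].
  - move=> _ _ [i Di <-] [j Dj <-]; have [k Dk le] := dir _ _ Di Dj.
    apply: le_trans (m_le k _ Dk).
    rewrite (is_measureU S0 (mP _ Dk).1)//.
    by apply: leeD; [have [] := le _ SA|have [] := le _ SB].
split => //; split.
- apply/eqP; rewrite eq_le s_ge0// andbT; apply: ge_ereal_sup => _ [i Di <-].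
  by have [[-> _ _] _] := mP _ Di.
- by move=> [A [B [_ /s_ge0 + _ sB]]]; rewrite sB.
- move=> F SF tF.
  have sF_ge0 n : 0 <= s (F n) by exact: s_ge0.
  have cv : cvgn (fun n => \sum_(0 <= i < n) s (F i)).
    by apply: is_cvg_nneseries => n _ _.
  suff -> : s (\bigcup_n F n) = \sum_(0 <= i <oo) s (F i) by exact: cv.
  apply/eqP; rewrite eq_le; apply/andP; split.
    apply: ge_ereal_sup => _ [i Di <-].
    have [[_ _ /(_ F SF tF) cvi] _] := mP _ Di.
    rewrite -(cvg_lim _ cvi)//; apply: lee_nneseries => n _.
      by move=> _; exact: m_ge0.
    exact: m_le.
  have SU n : S (\big[setU/set0]_(i < n) F i).
    by elim/big_ind : _ => // A B SA SB; exact: sigma_algebraU.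
  apply: lime_le => //; apply: nearW => n.
  apply: (@le_trans _ _ (s (\big[setU/set0]_(i < n) F i))); last first.
    by apply: s_mono => //; [exact: Sb|exact: bigsetU_bigcup].
  elim: n => [|n ih]; first by rewrite big_nil s_ge0.
  rewrite big_nat_recr//= big_ord_recr/=.
  apply: le_trans (sU _ _ (SU n) (SF n) _); first exact: leeD.
  rewrite -bigcup_mkord -subset0 => x [[k /= kn Fkx] Fnx].
  have /trivIsetP/(_ k n I I) := tF; rewrite ltn_eqF// => /(_ isT) FkFn.
  suff : (F k `&` F n) x by rewrite FkFn.
  by split.
Qed.

(** * Partial measures *)

(** If [m1 B] and [m2 B] are not both infinite, one of the two measures is finite
    on all the subsets of [B], and the difference is a measure there. *)
Lemma is_partial_measure_diff (R : realType) (T : Type) (S : set (set T))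
    (m1 m2 : set T -> \bar R) : sigma_algebra setT S ->
  is_positive_measure S m1 -> is_positive_measure S m2 ->
  is_partial_measure S (measure_diff S m1 m2).
Proof.
move=> hS pm1 pm2; have [mm1 m1_ge0] := pm1; have [mm2 m2_ge0] := pm2.
have [S0 _ _] := hS.
split => /=.
- by exists set0; split => //; have [-> _ _] := mm1; have [-> _ _] := mm2.
- by move=> A [].
move=> B [SB wp].
have trB : strace S B `<=` S by move=> A /(straceP _ hS SB)[].
have [_ _ trb] := sigma_algebra_strace B hS.
have le1 A : strace S B A -> m1 A <= m1 B.
  by move=> /(straceP _ hS SB)[SA AB]; exact: is_positive_measure_mono pm1 _ _ _.
have le2 A : strace S B A -> m2 A <= m2 B.
  by move=> /(straceP _ hS SB)[SA AB]; exact: is_positive_measure_mono pm2 _ _ _.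
have fin : m1 B < +oo \/ m2 B < +oo.
  move: wp; case: (m1 B) => [r| |]; case: (m2 B) => [r'| |] //= _;
   by [left; exact: ltry|left|right; exact: ltry|right].
have wpA A : strace S B A -> m1 A +? - m2 A.
  move=> sA; have SA := trB _ sA.
  have := m1_ge0 _ SA; have := m2_ge0 _ SA; have := le1 _ sA; have := le2 _ sA.
  case: (m1 A) => [r| |]; case: (m2 A) => [r'| |] //=.
  by rewrite !leye_eq => /eqP m2B /eqP m1B; move: fin; rewrite m1B m2B => -[].
split.
  by move=> A sA; split; [exact: trB|exact: wpA].
apply: is_measure_add => //.
- move=> [A [C [sA sC eA eC]]].
  have := m1_ge0 _ (trB _ sA); have := m2_ge0 _ (trB _ sA).
  have := m1_ge0 _ (trB _ sC); have := m2_ge0 _ (trB _ sC).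
  have := le1 _ sA; have := le2 _ sC.
  move: eA eC; case: (m1 A) => [r| |]; case: (m2 A) => [r'| |] //;
   case: (m1 C) => [t| |]; case: (m2 C) => [t'| |] // _ _;
   by rewrite !leye_eq => /eqP m2B /eqP m1B; move: fin; rewrite m1B m2B => -[].
- exact: is_measure_sub mm1.
- by apply: is_measureN; exact: is_measure_sub mm2.
Qed.

Section partial_measure.
Variables (R : realType) (T : Type) (S : set (set T)).
Hypothesis hS : sigma_algebra setT S.
Implicit Types mu : set_function R T.

Lemma sdom_subset mu A B : is_partial_measure S mu ->
  sdom mu B -> S A -> A `<=` B -> sdom mu A.
Proof.
move=> [_ dS pB] dB SA AB; have [+ _] := pB _ dB; apply.
by apply/(straceP _ hS (dS _ dB)).
Qed.

Lemma sdom0 mu : is_partial_measure S mu -> sdom mu set0.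
Proof.
move=> pmu; have [[B dB] dS pB] := pmu; have [S0 _ _] := hS.
exact: sdom_subset pmu dB _ _.
Qed.

Lemma partial_measureU mu A B : is_partial_measure S mu ->
  sdom mu (A `|` B) -> S A -> S B -> A `&` B = set0 ->
  mu (A `|` B) = mu A + mu B.
Proof.
move=> [_ dS pB] dAB SA SB AB.
have [S0 _ _] := hS; have [sub mmu] := pB _ dAB.
by apply: (is_measureU _ mmu) => //; apply/(straceP _ hS (dS _ dAB)); split.
Qed.

Lemma positive_sets_measure mu F : is_partial_measure S mu ->
  positive_sets S mu F -> is_positive_measure S (fun A => mu (A `&` F)).
Proof.
move=> [_ dS pB] [dF Fge0]; split.
  by apply: is_measure_restr; have [] := pB _ dF.
move=> A SA; apply: Fge0; last exact: subIsetr.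
by apply: sigma_algebraI => //; exact: dS.
Qed.

(** This is where maximality makes the positive sets a directed family:
    [mu] can be extended to the subsets of [F `|` G], so they are in its domain. *)
Lemma positive_setsU mu F G : is_maximal_partial_measure S mu ->
  positive_sets S mu F -> positive_sets S mu G -> positive_sets S mu (F `|` G).
Proof.
move=> [pmu maxmu] pF pG; have [dF Fge0] := pF; have [dG Gge0] := pG.
have [_ dS pB] := pmu.
have SF := dS _ dF; have SG := dS _ dG.
have SFG : S (F `|` G) by exact: sigma_algebraU.
have SGF : S (G `\` F) by exact: sigma_algebraD.
have dGF : sdom mu (G `\` F).
  by apply: sdom_subset pmu dG SGF _; exact: subDsetl.
have pGF : positive_sets S mu (G `\` F).
  split => // A SA AG; apply: Gge0 => //.
  exact: subset_trans AG (@subDsetl _ _ _).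
pose m A := mu (A `&` F) + mu (A `&` (G `\` F)).
have [mF mF_ge0] := positive_sets_measure pmu pF.
have [mG mG_ge0] := positive_sets_measure pmu pGF.
have m_ge0 A : S A -> 0 <= m A.
  by move=> SA; apply: adde_ge0; [exact: mF_ge0|exact: mG_ge0].
have mm : is_measure S m.
  apply: is_measure_add => //; first by have [] := hS.
  - by move=> A SA; apply: ge0_adde_def; rewrite inE; [exact: mF_ge0|exact: mG_ge0].
  - by move=> [A [B [_ /m_ge0 + _ mB]]]; rewrite [m B]mB.
have mE A : sdom mu A -> A `<=` F `|` G -> mu A = m A.
  move=> dA AFG; have SA := dS _ dA.
  have AE : A = (A `&` F) `|` (A `&` (G `\` F)).
    by rewrite -setIUr setUDr setDv setD0; apply/esym/setIidPl.
  rewrite {1}AE; apply: partial_measureU => //; rewrite -?AE//.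
  - exact: sigma_algebraI.
  - exact: sigma_algebraI.
  - by rewrite setIACA setDIK setI0.
(* [mu] and [m] agree where both make sense, so it does not matter which of the
   two is preferred there. *)
pose nu := SetFunction (sdom mu `|` [set A | S A /\ A `<=` F `|` G])
  (fun A => if `[< sdom mu A >] then mu A else m A).
have nuE A : S A -> A `<=` F `|` G -> nu A = m A.
  by move=> SA AFG /=; case: asboolP => // dA; exact: mE.
have numu A : sdom mu A -> nu A = mu A by move=> dA /=; case: asboolP.
have pnu : is_partial_measure S nu.
  split.
  - by exists F; left.
  - by move=> A [/dS|[]].
  move=> B dB; have SB : S B by case: dB => [/dS|[]].
  have [tr0 _ trb] := sigma_algebra_strace B hS.
  case: dB => [dB|[_ BFG]].
    have [sub mmu] := pB _ dB; split; first by move=> A /sub; left.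
    apply: eq_is_measure mmu => // A /sub dA.
    by rewrite numu.
  split.
    move=> A /(straceP _ hS SB)[SA AB]; right; split => //.
    exact: subset_trans BFG.
  apply: (@eq_is_measure _ _ _ m) => //.
  - move=> A /(straceP _ hS SB)[SA AB]; rewrite nuE//.
    exact: subset_trans BFG.
  - by apply: is_measure_sub mm => A /(straceP _ hS SB)[].
have dFG : sdom mu (F `|` G).
  rewrite -(maxmu nu pnu); first by right; split.
  by split => //; move=> A; left.
split => // A SA AFG; rewrite mE//; first exact: m_ge0.
exact: sdom_subset pmu dFG SA AFG.
Qed.

Lemma positive_part_measure mu : is_maximal_partial_measure S mu ->
  is_positive_measure S (positive_part S mu).
Proof.
move=> mmu; have [pmu _] := mmu; have [_ dS _] := pmu.
apply: (ereal_sup_directed_measure (m := fun F A => mu (A `&` F))) => //.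
- exists set0; split; first exact: sdom0.
  move=> A SA; rewrite subset0 => ->.
  by have [_ _ pB] := pmu; have [_ [-> _ _]] := pB _ (sdom0 pmu).
- by move=> F; exact: positive_sets_measure.
- move=> F G pF pG; have pFG := positive_setsU mmu pF pG.
  exists (F `|` G) => // A SA.
  have [SF SG SFG] : [/\ S F, S G & S (F `|` G)].
    by split; apply: dS; [case: pF|case: pG|case: pFG].
  have [_ ge0] := positive_sets_measure pmu pFG.
  have mono H : S H -> H `<=` F `|` G -> mu (A `&` H) <= mu (A `&` (F `|` G)).
    move=> SH HFG.
    have e : A `&` H = A `&` H `&` (F `|` G).
      by rewrite -setIA; congr (_ `&` _); apply/esym/setIidPl.
    rewrite e; apply: (is_positive_measure_mono (A := A `&` H) (B := A) hS
      (positive_sets_measure pmu pFG)) => //; exact: sigma_algebraI.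
  by split; apply: mono.
Qed.

Lemma partial_measure_hahn mu X : is_partial_measure S mu -> sdom mu X ->
  exists P, [/\ P `<=` X, positive_sets S mu P & negative_sets S mu (X `\` P)].
Proof.
move=> pmu dX; have [_ dS pB] := pmu; have SX := dS _ dX.
have [_ /is_measure_restr mX] := pB _ dX.
have [P [SP pos neg]] := hahn hS mX.
have SXP : S (X `&` P) by exact: sigma_algebraI.
exists (X `&` P); split; first exact: subIsetl.
  split; first by apply: sdom_subset pmu dX SXP _; exact: subIsetl.
  move=> A SA AXP; have /setIidPl <- : A `<=` X by move=> x /AXP[].
  by apply: pos => // x /AXP[].
split.
  by apply: sdom_subset pmu dX (sigma_algebraD hS SX SXP) _; exact: subDsetl.
move=> A SA AXP; have /setIidPl <- : A `<=` X by move=> x /AXP[].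
by apply: neg => // x /AXP[Xx nXP] Px; exact: nXP.
Qed.

(** The supremum defining the positive part is attained at the positive half of a
    Hahn decomposition: for a positive set [F], the part of [X `&` F] outside [P]
    has measure at most 0, and the part inside [P] has measure at most [mu P]. *)
Lemma positive_part_hahn mu X P : is_partial_measure S mu -> sdom mu X ->
  P `<=` X -> positive_sets S mu P -> negative_sets S mu (X `\` P) ->
  positive_part S mu X = mu P.
Proof.
move=> pmu dX PX pP [dN neg]; have [_ dS _] := pmu.
have [dP _] := pP.
have SX := dS _ dX; have SP := dS _ dP.
apply/eqP; rewrite eq_le; apply/andP; split; last first.
  by apply: ereal_sup_ubound; exists P => //; have /setIidPr -> := PX.
apply: ge_ereal_sup => _ [F pF <-]; have [dF pos] := pF; have SF := dS _ dF.
have SXF : S (X `&` F) by exact: sigma_algebraI.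
have SPF : S (P `&` F) by exact: sigma_algebraI.
have XFE : X `&` F = (P `&` F) `|` ((X `\` P) `&` F).
  by rewrite -setIUl setDUK.
have dXF : sdom mu (X `&` F).
  by apply: sdom_subset pmu dX SXF _; exact: subIsetl.
rewrite XFE partial_measureU//; first last.
- by rewrite setIACA setDIK set0I.
- by apply: sigma_algebraI => //; exact: sigma_algebraD.
- by rewrite -XFE.
have : mu ((X `\` P) `&` F) <= 0.
  apply: neg; last exact: subIsetl.
  by apply: sigma_algebraI => //; exact: sigma_algebraD.
move=> /(leeD (lexx (mu (P `&` F)))) /le_trans; apply.
rewrite adde0 setIC.
have := is_positive_measure_mono hS (positive_sets_measure pmu pP) SF.
have [_ SC _] := hS.
have ST : S setT by have [S0 /(_ _ S0)] := hS; rewrite setD0.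
by move=> /(_ _ ST (@subsetT _ _)); rewrite setTI.
Qed.

Lemma positive_part_min mu (mu1 : set T -> \bar R) : is_partial_measure S mu ->
  is_positive_measure S mu1 -> (forall A, sdom mu A -> mu A <= mu1 A) ->
  forall A, S A -> positive_part S mu A <= mu1 A.
Proof.
move=> pmu pmu1 le A SA; have [_ dS _] := pmu.
apply: ge_ereal_sup => _ [F [dF pos] <-]; have SF := dS _ dF.
have SAF : S (A `&` F) by exact: sigma_algebraI.
have dAF : sdom mu (A `&` F).
  by apply: sdom_subset pmu dF SAF _; exact: subIsetr.
apply: le_trans (le _ dAF) _.
by apply: (is_positive_measure_mono hS pmu1) => //; exact: subIsetl.
Qed.

Definition sf_opp mu : set_function R T :=
  SetFunction (sdom mu) (fun A => - mu A).

Lemma sf_oppK mu : sf_opp (sf_opp mu) = mu.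
Proof.
by case: mu => D f; congr SetFunction; apply/funext => A /=; rewrite oppeK.
Qed.

Lemma is_partial_measure_opp mu :
  is_partial_measure S mu -> is_partial_measure S (sf_opp mu).
Proof.
move=> [d0 dS pB]; split => // B dB; have [sub mB] := pB _ dB.
by split => //; exact: is_measureN.
Qed.

Lemma is_maximal_partial_measure_opp mu :
  is_maximal_partial_measure S mu -> is_maximal_partial_measure S (sf_opp mu).
Proof.
move=> [pmu maxmu]; split; first exact: is_partial_measure_opp.
move=> nu pnu [sub ext].
apply: (maxmu (sf_opp nu)); first exact: is_partial_measure_opp.
by split => // A dA /=; rewrite ext//= oppeK.
Qed.

Lemma positive_sets_opp mu : positive_sets S (sf_opp mu) = negative_sets S mu.
Proof.
by apply/seteqP; split => F [dF sgn]; split => // A SA AF;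
  have := sgn A SA AF; rewrite /= oppe_ge0.
Qed.

Lemma positive_part_opp mu : positive_part S (sf_opp mu) = negative_part S mu.
Proof. by apply/funext => A; rewrite /positive_part positive_sets_opp. Qed.

(** Both parts are computed on the same Hahn decomposition of [X], the negative
    one as the positive part of the opposite partial measure. *)
Lemma partial_measureE mu X : is_partial_measure S mu -> sdom mu X ->
  positive_part S mu X +? - negative_part S mu X /\
  mu X = positive_part S mu X - negative_part S mu X.
Proof.
move=> pmu dX; have [_ dS pB] := pmu; have SX := dS _ dX.
have [P [PX pP nN]] := partial_measure_hahn pmu dX.
have [dP Pge0] := pP; have [dN Nle0] := nN; have SP := dS _ dP; have SN := dS _ dN.
have XPP : X `\` (X `\` P) = P by rewrite setDD; apply/setIidPr.
rewrite (positive_part_hahn pmu dX PX pP nN).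
rewrite -positive_part_opp.
rewrite (@positive_part_hahn (sf_opp mu) X (X `\` P))//=; first last.
- by rewrite -positive_sets_opp sf_oppK XPP.
- by rewrite positive_sets_opp.
- exact: is_partial_measure_opp.
rewrite oppeK; split; last first.
  rewrite -[in LHS](setDUK PX); apply: partial_measureU; rewrite ?setDUK//.
  exact: setDIK.
have [_ [_ inf _]] := pB _ dX.
have : 0 <= mu P by exact: Pge0.
have : mu (X `\` P) <= 0 by exact: Nle0.
case EN : (mu (X `\` P)) => [r| |]; case EP : (mu P) => [r'| |] // _ _.
exfalso; apply: inf; exists P, (X `\` P); split => //.
  exact/(straceP _ hS SX).
by apply/(straceP _ hS SX); split => //; exact: subDsetl.
Qed.

End partial_measure.

(** * The Jordan decomposition of a maximal partial measure *)

Theorem theorem1 (R : realType) (T : Type) (S : set (set T))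
    (hS : sigma_algebra setT S) (mu : set_function R T)
    (hmu : is_maximal_partial_measure S mu) :
  [/\ is_positive_measure S (positive_part S mu),
      is_positive_measure S (negative_part S mu),
      sf_eq mu (measure_diff S (positive_part S mu) (negative_part S mu)),
      (forall mu1 : set T -> \bar R, is_positive_measure S mu1 ->
        (forall A, sdom mu A -> mu A <= mu1 A) ->
        forall A, S A -> positive_part S mu A <= mu1 A) &
      (forall mu2 : set T -> \bar R, is_positive_measure S mu2 ->
        (forall A, sdom mu A -> - mu A <= mu2 A) ->
        forall A, S A -> negative_part S mu A <= mu2 A)].
Proof.
have [pmu maxmu] := hmu.
have pos := positive_part_measure hS hmu.
have neg : is_positive_measure S (negative_part S mu).
  rewrite -positive_part_opp.
  exact/(positive_part_measure hS)/is_maximal_partial_measure_opp.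
split => //.
- split; last by move=> A /(partial_measureE hS pmu)[].
  apply/esym/maxmu; first exact: is_partial_measure_diff.
  split=> A dA; last by have [_ ->] := partial_measureE hS pmu dA.
  by split; [have [_ dS _] := pmu; exact: dS|have [] := partial_measureE hS pmu dA].
- by move=> mu1; exact: positive_part_min.
- move=> mu2 pmu2 le; rewrite -positive_part_opp.
  by apply: positive_part_min => //; exact: is_partial_measure_opp.
Qed.
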